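(* The chirp transform operator $T$ is not of weak-type $(2,2)$.
   Context: The chirp transform of $f\in L^1(\mathbb R)$ is $Tf(\lambda)=\int_{\mathbb R}f(x)e^{-\pi i\lambda x^2}\,dx$, $\lambda\in\mathbb R$. With $m$ the Lebesgue measure on $\mathbb R$, $T$ is of weak-type $(2,2)$ if there is a constant $C>0$ such that for every $\eta>0$ and every $f\in L^1(\mathbb R)\cap L^2(\mathbb R)$, $$m(\{\lambda\in\mathbb R:|Tf(\lambda)|>\eta\})\le\left(\frac{C\|f\|_2}{\eta}\right)^2.$$ *)

(* Defs.v *)
From HB Require Import structures.
From mathcomp Require Import all_boot all_order all_algebra.
From mathcomp Require Import all_classical all_reals all_analysis.
From mathcomp Require Import complex.
Set Implicit Arguments.
Unset Strict Implicit.
Unset Printing Implicit Defensive.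
Import Order.TTheory GRing.Theory Num.Theory.
Import numFieldNormedType.Exports.
Import ComplexField.Normc.

Local Open Scope classical_set_scope.
Local Open Scope ring_scope.
Local Open Scope complex_scope.

(* Complex-valued functions on the real line are total functions R -> R[i],
   read through their real and imaginary parts; [normc] is the modulus taken
   in R.  Measurability is with respect to the Borel sigma-algebra: every
   Lebesgue-measurable function agrees almost everywhere with a Borel one. *)
Definition cmeasurable (R : realType) (f : R -> R[i]) : Prop :=
  measurable_fun setT (fun x => complex.Re (f x)) /\
  measurable_fun setT (fun x => complex.Im (f x)).

Definition cLnorm (R : realType) (p : \bar R) (f : R -> R[i]) : \bar R :=
  ('N[@lebesgue_measure R]_p [EFin \o @normc R \o f])%E.

Definition cLfun (R : realType) (p : \bar R) (f : R -> R[i]) : Prop :=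
  cmeasurable f /\ (cLnorm p f < +oo)%E.

(* Meaningful when both parts of f are integrable. *)
Definition cintegral (R : realType) (f : R -> R[i]) : R[i] :=
  (\int[@lebesgue_measure R]_x complex.Re (f x))%R +i*
  (\int[@lebesgue_measure R]_x complex.Im (f x))%R.

Definition cexp (R : realType) (z : R[i]) : R[i] :=
  (expR (complex.Re z))%:C * (cos (complex.Im z) +i* sin (complex.Im z)).

Definition chirp_transform (R : realType) (f : R -> R[i]) (lambda : R) : R[i] :=
  cintegral (fun x => f x * cexp (- (pi%:C * 'i%C * lambda%:C * x%:C ^+ 2))).

(* The bound is an inequality of extended reals, so that the measure of the
   level set is not assumed to be finite. *)
Definition weak_type_2_2 (R : realType)
    (T : (R -> R[i]) -> R -> R[i]) : Prop :=
  exists2 C : R, 0 < C &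
    forall (eta : R) (f : R -> R[i]), 0 < eta -> cLfun 1%:E f -> cLfun 2%:E f ->
      (@lebesgue_measure R [set lambda | (eta < normc (T f lambda))%R] <=
       (C%:E * cLnorm 2%:E f / eta%:E) ^+ 2)%E.

(* Main.v *)
(* T is covariant under the parabolic scaling x ~ d, lambda ~ d^-2, while the
   weak-type (2,2) bound is not.  For f = 1_[0,d] and
   0 <= lambda <= 1/(pi d^2) the phase pi lambda x^2 stays in [0,1], so
   |Tf(lambda)| >= d cos 1.  At the level d cos 1 / 2 the weak-type bound would
   thus give 1/(pi d^2) <= 4 C^2 / (d (cos 1)^2), which is false for small d. *)
Require Import Defs.
From mathcomp Require Import all_boot all_order all_algebra.
From mathcomp Require Import all_classical all_reals all_analysis.
From mathcomp Require Import measurable_realfun complex ring lra.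
Import Order.TTheory GRing.Theory Num.Theory.
Import numFieldNormedType.Exports.
Import ComplexField.Normc.

Local Open Scope classical_set_scope.
Local Open Scope ring_scope.
Local Open Scope complex_scope.

Section chirp.
Context {R : realType}.
Implicit Types (A : set R) (z : R[i]).
Local Notation mu := (@lebesgue_measure R).

Definition cindic A (x : R) : R[i] := (\1_A x)%:C.

Lemma normc_cindic A x : normc (cindic A x) = \1_A x.
Proof. by rewrite /= expr0n /= addr0 sqrtr_sqr ger0_norm. Qed.

Lemma ler_Re_normc z : complex.Re z <= normc z.
Proof.
case: z => a b /=; apply: le_trans (ler_norm a) _.
by rewrite -sqrtr_sqr ler_wsqrtr// lerDl sqr_ge0.
Qed.

Lemma cLnorm_cindic A (p : R) : measurable A -> p != 0 ->
  cLnorm p%:E (cindic A) = (mu A `^ p^-1)%E.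
Proof.
move=> mA p0; rewrite /cLnorm unlock; congr (_ `^ _)%E.
rewrite -[A in RHS]setIT -integral_indic//; apply: eq_integral => x _.
rewrite /comp normc_cindic /= ger0_norm// indicE.
by case: (_ \in _); rewrite ?powR1 ?powR0.
Qed.

Lemma cLfun_cindic A (p : R) : measurable A -> (mu A < +oo)%E -> p != 0 ->
  cLfun p%:E (cindic A).
Proof.
move=> mA Aoo p0; split; first by split => /=; [exact: measurable_indic|].
by rewrite cLnorm_cindic// poweR_lty.
Qed.

(** The exponent is purely imaginary and the indicator real, so only the cosine of the phase
    survives. *)
Lemma Re_chirp_transform_cindic A (l : R) :
  complex.Re (chirp_transform (cindic A) l) =
  \int[mu]_(x in A) cos (pi * l * x ^+ 2).
Proof.
rewrite [RHS]Rintegral_mkcond /chirp_transform /cintegral /=.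
apply: eq_Rintegral => x _.
rewrite patchE indicE !expr2 /= !(mul0r, mulr0, mulr1, subr0, addr0, add0r).
rewrite oppr0 !mul0r oppr0 expR0 cosN mul1r.
by case: (_ \in _); rewrite ?mul1r ?mul0r.
Qed.

Lemma lt_normc_chirp_transform (d l : R) : 0 < d -> 0 <= l ->
  pi * l * d ^+ 2 <= 1 ->
  d * cos 1 / 2 < normc (chirp_transform (cindic `[0, d]) l).
Proof.
move=> d0 l0 ld; apply: lt_le_trans (ler_Re_normc _).
rewrite Re_chirp_transform_cindic.
have c0 := @cos1_gt0 R.
have mud : fine (mu `[0, d]) = d.
  by rewrite lebesgue_measure_itv /= lte_fin d0 sube0.
have cont (f : R -> R) : continuous f ->
    mu.-integrable `[0, d] (EFin \o f).
  move=> cf; apply: continuous_compact_integrable; first exact: segment_compact.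
  exact: continuous_subspaceT.
(* The integral is at least [cos 1 * d]; halving this level gives the strict inequality. *)
apply: (@lt_le_trans _ _ (cos 1 * d)); first by rewrite mulrC; nra.
rewrite -[X in _ * X <= _]mud -Rintegral_cst//; apply: le_Rintegral => //.
- exact/cont/cst_continuous.
- apply: cont => x; apply: continuous_comp; last exact: continuous_cos.
  by apply: continuousM; [exact: cst_continuous|exact: exprn_continuous].
move=> x /=; rewrite in_itv/= => /andP[x0 xd].
have pi2 := pi_ge2 R.
have pl0 : 0 <= pi * l by rewrite mulr_ge0// pi_ge0.
have px : pi * l * x ^+ 2 <= 1.
  apply: le_trans ld; rewrite ler_wpM2l// ler_sqr ?nnegrE//; exact: ltW.
(* Cosine decreases on [[0, pi]], which contains both the phase and 1 because [pi >= 2]. *)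
by rewrite leNgt ltr_cos -?leNgt// in_itv/= ?mulr_ge0 ?sqr_ge0//=; lra.
Qed.

(* No measurability is needed: the library's Lebesgue measure of an arbitrary
   set is its outer measure. *)
Lemma le_lebesgue_measure A B : A `<=` B -> (mu A <= mu B)%E.
Proof. exact: (le_mu_ext (wlength idfun)). Qed.

End chirp.

Theorem corollary1 (R : realType) : ~ weak_type_2_2 (@chirp_transform R).
Proof.
move=> [C C0 wC].
have c0 := @cos1_gt0 R.
have p0 := pi_gt0 R.
(* Chosen so that the weak-type bound [4 C^2 / (d (cos 1)^2)] is exactly half of [1 / (pi d^2)]. *)
pose d := cos 1 ^+ 2 / (8 * pi * C ^+ 2) : R.
have d0 : 0 < d by rewrite divr_gt0 ?mulr_gt0 ?exprn_gt0.
have mud : lebesgue_measure `[0%R, d]%classic = d%:E.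
  by rewrite lebesgue_measure_itv /= lte_fin d0 sube0.
have Lp p : p != 0 -> cLfun p%:E (cindic `[0, d]%classic).
  by move=> ?; apply: cLfun_cindic => //; rewrite mud ltry.
have eta0 : 0 < d * cos 1 / 2 by rewrite divr_gt0// mulr_gt0.
have n2 : 2 != 0 :> R by rewrite pnatr_eq0.
have := wC _ _ eta0 (Lp 1 (oner_neq0 _)) (Lp 2 n2).
apply/negP; rewrite -ltNge.
(* The largest [l] with [pi * l * d ^+ 2 <= 1], so the level set contains [[0, b]]. *)
pose b : R := (pi * d ^+ 2)^-1.
have b0 : 0 < b by rewrite invr_gt0 mulr_gt0 ?exprn_gt0.
apply: (@lt_le_trans _ _ (lebesgue_measure `[0%R, b]%classic)); last first.
  apply: le_lebesgue_measure => l /=; rewrite in_itv/= => /andP[l0 lb].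
  apply: lt_normc_chirp_transform => //.
  rewrite mulrAC -ler_pdivlMl ?mulr1//.
  by rewrite mulr_gt0 ?exprn_gt0.
rewrite lebesgue_measure_itv /= lte_fin b0 sube0.
rewrite cLnorm_cindic// mud poweR_EFin powR12_sqrt ?ltW// inver gt_eqF//.
rewrite -!EFinM lte_fin -expr2 !exprMn sqr_sqrtr ?ltW//.
suff -> : C ^+ 2 * d * (d * cos 1 / 2)^-1 ^+ 2 = b / 2 by lra.
(* The identity holds with any positive [q] in place of [pi]. *)
rewrite /b /d; move: p0; move: (pi : R) => q q0.
by field; rewrite !gt_eqF.
Qed.
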